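(* Let $n\ge 1$ and let $\Delta=(\Delta_{ij})$ be an integer $n\times n$ matrix. Then $\Delta$ is a toppling matrix if and only if it satisfies all of the following conditions: $\det\Delta\neq 0$; $\Delta_{ij}\le 0$ for all $i\ne j$; and there exists a row vector $\mathbf r\in\mathbb Z^n$ such that $\mathbf r>0$ and $\mathbf r\Delta\ge 0$.
   Context: For a vector $\mathbf v$, $\mathbf v>0$ means every entry is positive and $\mathbf v\ge 0$ means every entry is nonnegative. An integer $n\times n$ matrix $\Delta$ is a toppling matrix if $\Delta_{ij}\le 0$ for all $i\neq j$ and there exists a column vector $\mathbf h\in\mathbb Z^n$ with $\mathbf h>0$ and $\Delta\mathbf h>0$. *)

(* Defs.v *)
From mathcomp Require Import all_boot all_order all_algebra.

Set Implicit Arguments.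
Unset Strict Implicit.
Unset Printing Implicit Defensive.

Import Order.TTheory GRing.Theory Num.Theory.
Local Open Scope ring_scope.

(* Entrywise order on integer matrices; in particular on row and column
   vectors. Strict positivity means that every entry is positive, not merely
   "nonnegative and nonzero". *)
Definition mx_pos (m n : nat) (A : 'M[int]_(m, n)) : Prop :=
  forall i j, 0 < A i j.

Definition mx_nneg (m n : nat) (A : 'M[int]_(m, n)) : Prop :=
  forall i j, 0 <= A i j.

Definition offdiag_npos (n : nat) (Delta : 'M[int]_n) : Prop :=
  forall i j : 'I_n, i != j -> Delta i j <= 0.

Definition toppling_matrix (n : nat) (Delta : 'M[int]_n) : Prop :=
  offdiag_npos Delta /\
  exists h : 'cV[int]_n, mx_pos h /\ mx_pos (Delta *m h).

(* Main.v *)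
(** With the off-diagonal sign condition, [Delta h > 0] for some [h > 0] forces
    [Delta] to be monotone ([Delta x >= 0] implies [x >= 0]): if [x] had a
    negative entry, subtracting from [x] the multiple of [h] given by the
    smallest ratio [x_i / h_i] would leave a nonnegative vector whose zero set
    [S] violates the strict inequality. If only [Delta h >= 0], then the
    coordinate space of [S] is invariant under right multiplication by [Delta],
    hence equal to its image when [Delta] is nonsingular, whereas [Delta h]
    vanishes on [S]; so monotonicity persists. A monotone nonsingular matrix has
    a nonnegative inverse, whose column sums form a positive row vector [r] with
    [r Delta > 0] after clearing the determinant. One implication applies this
    to [Delta], the other to its transpose. *)
Require Import Defs.
From mathcomp Require Import all_boot all_order all_algebra.

Set Implicit Arguments.
Unset Strict Implicit.
Unset Printing Implicit Defensive.

Import Order.TTheory GRing.Theory Num.Theory.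
Local Open Scope ring_scope.

Definition mx_monotone (n : nat) (A : 'M[int]_n) : Prop :=
  forall x : 'cV[int]_n, mx_nneg (A *m x) -> mx_nneg x.

Lemma exists_min_ratio (n : nat) (r x : 'cV[int]_n) (i0 : 'I_n) :
  mx_pos r -> exists i, forall j, x i 0 * r j 0 <= x j 0 * r i 0.
Proof.
move=> r_gt0.
pose ratio i : rat := (x i 0)%:~R / (r i 0)%:~R.
case: (arg_minP (P := xpredT) ratio (i0 := i0)) => // i _ min_i.
exists i => j; have := min_i j isT; rewrite /ratio.
by rewrite ler_pdivrMr ?ltr0z // mulrAC ler_pdivlMr ?ltr0z // -!intrM ler_int.
Qed.

(** On the zero set of [y], the sign condition gives [(B *m y) k 0 <= 0], while [B *m y] is a
    nonnegative combination of [B *m x] and [B *m r]; so every term on either side vanishes. *)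
Lemma not_monotone_invariant (n : nat) (B : 'M[int]_n) (r x : 'cV[int]_n) :
  offdiag_npos B -> mx_pos r -> mx_nneg (B *m r) -> mx_nneg (B *m x) ->
  ~ mx_nneg x ->
  exists2 S : {set 'I_n}, S != set0 &
    {in S, forall k, (B *m r) k 0 = 0 /\ forall j, j \notin S -> B k j = 0}.
Proof.
move=> Boff r_gt0 Br_ge0 Bx_ge0 x_nge0.
have [i0 xi0] : exists i0, x i0 0 < 0.
  case: (boolP [forall i, 0 <= x i 0]) => [/forallP x_ge0|].
    by case: x_nge0 => i j; rewrite ord1.
  by rewrite negb_forall => /existsP[i0]; rewrite -ltNge; exists i0.
have [i min_i] := exists_min_ratio x i0 r_gt0.
have xi_lt0 : x i 0 < 0.
  rewrite -(pmulr_llt0 _ (r_gt0 i0 0)); apply: le_lt_trans (min_i i0) _.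
  by rewrite pmulr_llt0 ?r_gt0.
(* This is [x - (x_i / r_i) r] scaled by [r_i > 0] to stay integral; minimality of the ratio at [i]
   makes it nonnegative. *)
pose y := r i 0 *: x - x i 0 *: r.
have yE j : y j 0 = x j 0 * r i 0 - x i 0 * r j 0.
  by rewrite !mxE [r i 0 * _]mulrC.
have y_ge0 j : 0 <= y j 0 by rewrite yE subr_ge0.
exists [set k | y k 0 == 0].
  by apply/set0Pn; exists i; rewrite inE yE subrr.
move=> k; rewrite inE => /eqP yk0.
have By_k : (B *m y) k 0 = r i 0 * (B *m x) k 0 + - x i 0 * (B *m r) k 0.
  by rewrite mulmxBr -!scalemxAr !mxE mulNr.
(* The diagonal entry, whose sign is unconstrained, is killed by [y k 0 = 0]. *)
have term_ge0 j : 0 <= - (B k j * y j 0).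
  have [<-|neq_kj] := eqVneq k j; first by rewrite yk0 mulr0 oppr0.
  by rewrite oppr_ge0 mulr_le0_ge0 ?Boff.
have t1 : 0 <= r i 0 * (B *m x) k 0 by rewrite mulr_ge0 ?Bx_ge0 // ltW.
have t2 : 0 <= - x i 0 * (B *m r) k 0.
  by rewrite mulr_ge0 ?Br_ge0 // oppr_ge0 ltW.
have By_k0 : (B *m y) k 0 = 0.
  apply/eqP; rewrite eq_le {2}By_k (addr_ge0 t1 t2) andbT.
  by rewrite mxE -oppr_ge0 -sumrN sumr_ge0.
split.
  move/eqP: By_k0; rewrite By_k (paddr_eq0 t1 t2) => /andP[_].
  by rewrite mulf_eq0 oppr_eq0 (lt_eqF xi_lt0) => /eqP.
move=> j; rewrite inE => yj_neq0; apply/eqP.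
have : \sum_j - (B k j * y j 0) == 0.
  by rewrite sumrN oppr_eq0; move: By_k0; rewrite mxE => ->.
rewrite psumr_eq0 // => /allP/(_ j (mem_index_enum j)).
by rewrite oppr_eq0 mulf_eq0 (negPf yj_neq0) orbF.
Qed.

Lemma det_neq0_no_invariant (n : nat) (B : 'M[int]_n) (r : 'cV[int]_n)
    (S : {set 'I_n}) :
  \det B != 0 ->
  {in S, forall k, (B *m r) k 0 = 0 /\ forall j, j \notin S -> B k j = 0} ->
  {in S, forall k, r k 0 = 0}.
Proof.
move=> detB invS k kS.
pose BQ := map_mx (intr : int -> rat) B.
pose rQ := map_mx (intr : int -> rat) r.
have BQfree : row_free BQ.
  by rewrite row_free_unit unitmxE det_map_mx unitfE intr_eq0.
(* Projection onto the coordinates in [S]; [PB] says that its row space is stable under [BQ]. *)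
pose P : 'M[rat]_n := diag_mx (\row_j (j \in S)%:R).
have PB : P *m BQ = P *m BQ *m P.
  apply/matrixP => i j; rewrite mul_mx_diag mul_diag_mx !mxE.
  have [iS|_] := boolP (i \in S); last by rewrite !mul0r.
  have [jS|jS] := boolP (j \in S); first by rewrite mulr1.
  by rewrite (invS i iS).2 // mulr0.
have PB_le : (P *m BQ <= P)%MS by rewrite PB submxMl.
(* [BQ] preserves rank, so the inclusion [PB_le] is an equality; then [P = D P BQ] sends [rQ] to
   [D (P BQ rQ) = 0]. *)
have /submxP[D PE] : (P <= P *m BQ)%MS.
  by rewrite -(mxrank_leqif_sup PB_le) mxrankMfree.
have PBr : P *m BQ *m rQ = 0.
  rewrite -mulmxA -map_mxM; apply/matrixP => i j.
  rewrite ord1 mul_diag_mx !mxE.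
  have [iS|_] := boolP (i \in S); last by rewrite mul0r.
  by have := (invS i iS).1; rewrite mxE => ->; rewrite mulr0.
have : (P *m rQ) k 0 = 0 by rewrite PE -mulmxA PBr mulmx0 mxE.
by rewrite mul_diag_mx !mxE kS mul1r => /eqP; rewrite intr_eq0 => /eqP.
Qed.

Lemma mx_nneg_dec (m n : nat) (A : 'M[int]_(m, n)) : mx_nneg A \/ ~ mx_nneg A.
Proof.
case: (boolP [forall i, [forall j, 0 <= A i j]]) => [/forallP A_ge0|nA].
  by left=> i j; exact: forallP (A_ge0 i) j.
by right=> A_ge0; case/negP: nA; apply/forallP=> i; apply/forallP=> j.
Qed.

Lemma toppling_monotone (n : nat) (A : 'M[int]_n) :
  toppling_matrix A -> mx_monotone A.
Proof.
case=> Aoff [h [h_gt0 Ah_gt0]] x Ax_ge0.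
have [//|nx] := mx_nneg_dec x.
have Ah_ge0 : mx_nneg (A *m h) by move=> i j; rewrite ltW.
have [S /set0Pn[k kS] inv] := not_monotone_invariant Aoff h_gt0 Ah_ge0 Ax_ge0 nx.
by have := Ah_gt0 k 0; rewrite (inv k kS).1 ltxx.
Qed.

Lemma nonsingular_monotone (n : nat) (A : 'M[int]_n) (h : 'cV[int]_n) :
  \det A != 0 -> offdiag_npos A -> mx_pos h -> mx_nneg (A *m h) ->
  mx_monotone A.
Proof.
move=> detA Aoff h_gt0 Ah_ge0 x Ax_ge0.
have [//|nx] := mx_nneg_dec x.
have [S /set0Pn[k kS] inv] := not_monotone_invariant Aoff h_gt0 Ah_ge0 Ax_ge0 nx.
by have := h_gt0 k 0; rewrite (det_neq0_no_invariant detA inv kS) ltxx.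
Qed.

(** Monotonicity applies to a kernel vector and to its opposite, so both are nonnegative. *)
Lemma monotone_det_neq0 (n : nat) (A : 'M[int]_n) :
  mx_monotone A -> \det A != 0.
Proof.
move=> Amon; rewrite -det_tr; apply/negP => /det0P[v /eqP v_neq0 vA].
have Av : A *m v^T = 0 by rewrite -[A]trmxK -trmx_mul vA trmx0.
apply: v_neq0; apply/rowP => i; apply/eqP; rewrite eq_le mxE.
have zero_ge0 : mx_nneg (A *m v^T) by rewrite Av => a b; rewrite mxE.
have zero_ge0N : mx_nneg (A *m - v^T).
  by rewrite mulmxN Av oppr0 => a b; rewrite mxE.
have := Amon _ zero_ge0 i 0; have := Amon _ zero_ge0N i 0.
by rewrite !mxE oppr_ge0 => -> ->.
Qed.

Lemma monotone_pos_row (n : nat) (A : 'M[int]_n) :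
  mx_monotone A -> exists r : 'rV[int]_n, mx_pos r /\ mx_pos (r *m A).
Proof.
move=> Amon; have detA := monotone_det_neq0 Amon.
(* An integral multiple of the inverse: [C] is [|det A|] times [A^-1]. *)
pose C := Num.sg (\det A) *: \adj A.
have AC : A *m C = `|\det A|%:M.
  by rewrite -scalemxAr mul_mx_adj scale_scalar_mx -normrEsg.
have CA : C *m A = `|\det A|%:M.
  by rewrite -scalemxAl mul_adj_mx scale_scalar_mx -normrEsg.
have C_ge0 i j : 0 <= C i j.
  have AC_ge0 : mx_nneg (A *m col j C).
    by rewrite colE mulmxA AC -colE => a b; rewrite !mxE mulrn_wge0.
  by have := Amon _ AC_ge0 i 0; rewrite mxE.
exists (const_mx 1 *m C); split=> i j; last first.
  by rewrite -mulmxA CA mul_mx_scalar !mxE mulr1 normr_gt0.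
have sumE : (const_mx 1 *m C) i j = \sum_k C k j.
  by rewrite mxE; apply: eq_bigr => k _; rewrite mxE mul1r.
(* A zero column sum would make column [j] of [C] zero, against [(A *m C) j j = |det A|]. *)
rewrite sumE lt_def sumr_ge0 // andbT psumr_eq0 //; apply/negP => /allP C_j0.
have : (A *m C) j j = 0.
  rewrite mxE big1 // => k _.
  by rewrite (eqP (C_j0 k (mem_index_enum k))) mulr0.
by rewrite AC !mxE eqxx mulr1n => /eqP; rewrite normr_eq0 (negPf detA).
Qed.

Theorem proposition3p1 (n : nat) (n_ge1 : (1 <= n)%N) (Delta : 'M[int]_n) :
  toppling_matrix Delta <->
  [/\ \det Delta != 0,
      offdiag_npos Delta &
      exists r : 'rV[int]_n, mx_pos r /\ mx_nneg (r *m Delta)].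
Proof.
split=> [top|[detD Doff [r [r_gt0 rD_ge0]]]].
  have Dmon := toppling_monotone top.
  have [r [r_gt0 rD_gt0]] := monotone_pos_row Dmon.
  split; [exact: monotone_det_neq0 | exact: top.1 | exists r; split=> // i j].
  by rewrite ltW.
have DTmon : mx_monotone Delta^T.
  apply: (@nonsingular_monotone _ _ r^T).
  - by rewrite det_tr.
  - by move=> i j neq_ij; rewrite mxE Doff // eq_sym.
  - by move=> i j; rewrite mxE.
  - by rewrite -trmx_mul => i j; rewrite mxE.
have [h [h_gt0 hD_gt0]] := monotone_pos_row DTmon.
split=> //; exists h^T; split=> [i j|i j]; first by rewrite mxE.
by rewrite -[Delta]trmxK -trmx_mul mxE.
Qed.
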